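(* Let $A \subset \mathbb{Z}_{>0}$ be a finite set of size $n$ whose elements are co-prime (i.e. the greatest common divisor of all elements of $A$ is $1$). Then either $A = \{1,2\}$ or $s(A) \geq (n+2)/3$.
   Context: A set $B \subset \mathbb{Z}_{>0}$ is sum-free if there are no $x,y,z \in B$ (with $x=y$ allowed) such that $x+y=z$. For a finite set $A \subset \mathbb{Z}_{>0}$, $s(A)$ denotes the size of the largest sum-free subset of $A$. *)

(* Defs.v *)
From mathcomp Require Import all_boot finmap.

Set Implicit Arguments.
Unset Strict Implicit.
Unset Printing Implicit Defensive.

Definition sum_free (B : {fset nat}) : bool :=
  ~~ [exists x : B, exists y : B, exists z : B, val x + val y == val z].

Definition max_sum_free (A : {fset nat}) : nat :=
  \max_(B <- fpowerset A | sum_free B) #|` B|%fset.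

Lemma sum_freeP (B : {fset nat}) :
  reflect (~ exists x y z : nat, [/\ x \in B, y \in B, z \in B & x + y = z])
          (sum_free B).
Proof.
apply: (iffP negP) => H E; apply: H.
- case: E => x [y [z [xB yB zB e]]].
  apply/existsP; exists [` xB]%fset; apply/existsP; exists [` yB]%fset.
  by apply/existsP; exists [` zB]%fset; apply/eqP.
- case/existsP: E => x /existsP[y /existsP[z /eqP e]].
  by exists (val x), (val y), (val z); split=> //; apply: valP.
Qed.

(* Main.v *)
Require Import Defs.
From Stdlib Require Import Reals Lra ZArith.
From Coquelicot Require Import Coquelicot.
From HB Require Import structures.
From mathcomp Require Import all_boot all_order all_algebra finmap zify.

(** For real [x], the set of [a] in [A] with [frac (a x)] in [[1/3, 2/3)] is
    sum-free.  Hence, if [s(A) < (n+2)/3], the function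
    [h(x) = n + 1 - 3 #{a in A | frac (a x) in [1/3, 2/3)}] is nonnegative on
    [[0, 1]].  Its mean is [1] and its [k]-th cosine coefficient is
    [kappa * sum_(a in A, a | k) chi(k/a) / (k/a)], where [chi] is the nontrivial
    character mod 3 and [kappa = 3 sqrt 3 / (2 pi) > 4/5].  Such large coefficients
    are very restrictive for a nonnegative function of mean [1].  If [a = min A] and
    [b] is the least non-multiple of [a] in [A], then the coefficients at [a] and [b]
    are [kappa] and the one at [b - a] is [0], which contradicts
    [int h |3/2 - e(ax) - e(bx)|^2 >= 0]; so [a] divides [gcd A = 1].  Testing
    against [(cos - 4/5)^2] gives [2 \in A], and two further nonnegative trigonometric
    polynomials exclude a least element [m > 2] of [A]. *)

Set Implicit Arguments.
Unset Strict Implicit.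
Unset Printing Implicit Defensive.

Delimit Scope R_scope with Re.
Delimit Scope Z_scope with BZ.

HB.instance Definition _ := Monoid.isComLaw.Build R 0%Re Rplus
  (fun x y z => esym (Rplus_assoc x y z)) Rplus_comm Rplus_0_l.

(** * Middle thirds of the circle and integrals over them *)

Section FourierCoefficients.

Local Open Scope R_scope.

(** The floor of [3 a x] is [1] mod 3 exactly when [frac (a x)] lies in [[1/3, 2/3)]; this form
    reduces sum-freeness to integer arithmetic. *)
Definition middle_third (x : R) (a : nat) : bool :=
  Z.eqb (Int_part (3 * INR a * x) mod 3)%BZ 1%BZ.

Definition middle_indicator (a : nat) (x : R) : R :=
  if middle_third x a then 1 else 0.

Lemma Int_partE (z : Z) (r : R) : IZR z <= r < IZR z + 1 -> Int_part r = z.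
Proof. by move=> h; symmetry; apply: Int_part_spec; lra. Qed.

(** The floor of a sum is the sum of the floors or one more; with both floors [1] mod 3 it is [2] or
    [0], never [1]. *)
Lemma middle_third_sum_free (x : R) (a b : nat) :
  middle_third x a -> middle_third x b -> ~~ middle_third x (a + b)%N.
Proof.
move=> /Z.eqb_eq ha /Z.eqb_eq hb; apply/negP => /Z.eqb_eq.
have -> : 3 * INR (a + b)%N * x = 3 * INR a * x + 3 * INR b * x.
  by rewrite -plusE plus_INR; ring.
have [a1 a2] := base_Int_part (3 * INR a * x).
have [b1 b2] := base_Int_part (3 * INR b * x).
have [s1 s2] := base_Int_part (3 * INR a * x + 3 * INR b * x).
move: ha hb a1 a2 b1 b2 s1 s2.
move: (Int_part _) (Int_part _) (Int_part _) => w v u.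
move=> ha hb a1 a2 b1 b2 s1 s2 hw.
have l1 : (u + v < w + 1)%BZ by apply: lt_IZR; rewrite !plus_IZR; lra.
have l2 : (w < u + v + 2)%BZ by apply: lt_IZR; rewrite !plus_IZR; lra.
by Z.to_euclidean_division_equations; lia.
Qed.

Lemma middle_indicator_third (a j i : nat) (x : R) : (0 < a)%N -> (i < 3)%N ->
  (INR j + INR i / 3) / INR a < x < (INR j + INR i.+1 / 3) / INR a ->
  middle_indicator a x = if i == 1%N then 1 else 0.
Proof.
move=> a0 i3 [h1 h2].
have a0' : 0 < INR a by apply: lt_0_INR; lia.
have l1 : 3 * INR j + INR i < 3 * INR a * x.
  have := Rmult_lt_compat_l (3 * INR a) _ _ ltac:(lra) h1.
  have -> : 3 * INR a * ((INR j + INR i / 3) / INR a) = 3 * INR j + INR i by field; lra.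
  by [].
have l2 : 3 * INR a * x < 3 * INR j + INR i + 1.
  have := Rmult_lt_compat_l (3 * INR a) _ _ ltac:(lra) h2.
  have -> : 3 * INR a * ((INR j + INR i.+1 / 3) / INR a) = 3 * INR j + INR i + 1.
    by rewrite S_INR; field; lra.
  by [].
rewrite /middle_indicator /middle_third.
have -> : Int_part (3 * INR a * x) = (3 * Z.of_nat j + Z.of_nat i)%BZ.
  by apply: Int_partE; rewrite plus_IZR mult_IZR -!INR_IZR_INZ; lra.
have -> : ((3 * Z.of_nat j + Z.of_nat i) mod 3)%BZ = Z.of_nat i.
  by Z.to_euclidean_division_equations; lia.
by case: i i3 {h1 h2 l1 l2} => [|[|[|]]].
Qed.

Lemma is_RInt_middle_third (S C : R -> R) (a j i : nat) : (0 < a)%N -> (i < 3)%N ->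
  (forall x, is_derive S x (C x)) -> (forall x, continuous C x) ->
  is_RInt (fun x => middle_indicator a x * C x)
    ((INR j + INR i / 3) / INR a) ((INR j + INR i.+1 / 3) / INR a)
    (if i == 1%N then
       S ((INR j + INR i.+1 / 3) / INR a) - S ((INR j + INR i / 3) / INR a)
     else 0).
Proof.
move=> a0 i3 dS cC.
have a0' : 0 < INR a by apply: lt_0_INR; lia.
have le : (INR j + INR i / 3) / INR a <= (INR j + INR i.+1 / 3) / INR a.
  apply: Rmult_le_compat_r; first by left; apply: Rinv_0_lt_compat.
  by rewrite S_INR; lra.
apply: (is_RInt_ext (fun x => (if i == 1%N then 1 else 0) * C x)).
  move=> x; rewrite Rmin_left // Rmax_right // => hx.
  by rewrite (middle_indicator_third a0 i3 hx).
case: ifP => _.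
  apply: (is_RInt_ext C); first by move=> x _; rewrite Rmult_1_l.
  exact: (is_RInt_derive S).
apply: (is_RInt_ext (fun=> 0)); first by move=> x _; rewrite Rmult_0_l.
by have := is_RInt_const ((INR j + INR i / 3) / INR a) ((INR j + INR i.+1 / 3) / INR a) 0;
  rewrite /scal /= /mult /= Rmult_0_r.
Qed.

(** Each of the [a] periods splits into thirds; only the middle one contributes, by an increment of
    the antiderivative [S]. *)
Lemma is_RInt_middle (S C : R -> R) (a : nat) : (0 < a)%N ->
  (forall x, is_derive S x (C x)) -> (forall x, continuous C x) ->
  is_RInt (fun x => middle_indicator a x * C x) 0 1
    (\big[Rplus/0]_(j < a)
       (S ((INR j + 2 / 3) / INR a) - S ((INR j + 1 / 3) / INR a))).
Proof.
move=> a0 dS cC.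
have a0' : 0 < INR a by apply: lt_0_INR; lia.
suff H n : is_RInt (fun x => middle_indicator a x * C x) 0 (INR n / INR a)
    (\big[Rplus/0]_(j < n)
       (S ((INR j + 2 / 3) / INR a) - S ((INR j + 1 / 3) / INR a))).
  by have := H a; rewrite /Rdiv Rinv_r //; lra.
elim: n => [|n IH].
  rewrite big_ord0 /= /Rdiv Rmult_0_l; exact: (is_RInt_point _ 0).
rewrite big_ord_recr S_INR.
apply: (is_RInt_Chasles _ _ (INR n / INR a)) => //.
have h0 := @is_RInt_middle_third S C a n 0 a0 isT dS cC.
have h1 := @is_RInt_middle_third S C a n 1 a0 isT dS cC.
have h2 := @is_RInt_middle_third S C a n 2 a0 isT dS cC.
have := is_RInt_Chasles _ _ _ _ _ _ (is_RInt_Chasles _ _ _ _ _ _ h0 h1) h2.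
rewrite /= /plus /=.
have -> : INR n + 0 / 3 = INR n by field.
have -> : INR n + (1 + 1 + 1) / 3 = INR n + 1 by field.
have -> : 1 + 1 = 2 by ring.
by rewrite Rplus_0_l Rplus_0_r.
Qed.

(** * Sine sums and the resulting cosine integrals *)

(** Telescoping: [2 sin(d/2) sin(t + j d) = cos(t + j d - d/2) - cos(t + j d + d/2)]. *)
Lemma sum_sin_progression (n : nat) (t d : R) :
  2 * sin (d / 2) * \big[Rplus/0]_(j < n) sin (t + INR j * d) =
  cos (t - d / 2) - cos (t + INR n * d - d / 2).
Proof.
elim: n => [|n IH]; first by rewrite big_ord0 /= Rmult_0_l Rplus_0_r; ring.
rewrite big_ord_recr /= Rmult_plus_distr_l IH -/(INR n.+1) S_INR.
have -> : t + (INR n + 1) * d - d / 2 = (t + INR n * d) + d / 2 by field.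
by rewrite !cos_minus !cos_plus; ring.
Qed.

(** The [a] steps make [k] full turns, so the telescoped difference vanishes, while the factor
    [sin(PI k / a)] is zero only if [a] divides [k]. *)
Lemma sum_sin_nondivisor (a k : nat) (t : R) : (0 < a)%N -> ~~ (a %| k)%N ->
  \big[Rplus/0]_(j < a) sin (t + INR j * (2 * PI * INR k / INR a)) = 0.
Proof.
move=> a0 nak.
have a0' : 0 < INR a by apply: lt_0_INR; lia.
have := sum_sin_progression a t (2 * PI * INR k / INR a).
have -> : t + INR a * (2 * PI * INR k / INR a) - 2 * PI * INR k / INR a / 2 =
          (t - 2 * PI * INR k / INR a / 2) + 2 * INR k * PI by field; lra.
rewrite cos_period Rminus_diag => /Rmult_integral [/Rmult_integral [|s0]|//]; first lra.
case: (sin_eq_0_0 _ s0) => z hz; case/negP: nak.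
have pi0 := PI_RGT_0.
have : INR k = IZR z * INR a.
  apply: (Rmult_eq_reg_l (PI / INR a)).
    have -> : PI / INR a * INR k = 2 * PI * INR k / INR a / 2 by field; lra.
    by rewrite hz; field; lra.
  by apply: Rmult_integral_contrapositive_currified; [lra | apply: Rinv_neq_0_compat; lra].
rewrite !INR_IZR_INZ -mult_IZR => /eq_IZR e.
apply/dvdnP; exists (Z.to_nat z); nia.
Qed.

Definition chi3 (r : nat) : R := match (r %% 3)%N with 1%N => 1 | 2%N => -1 | _ => 0 end.

Definition kappa : R := 3 * sqrt 3 / (2 * PI).

Lemma sin_third (r : nat) : sin (2 * PI * INR r / 3) = sqrt 3 / 2 * chi3 r.
Proof.
rewrite {1}(divn_eq r 3) -plusE -multE plus_INR mult_INR.
have -> : 2 * PI * (INR (r %/ 3) * INR 3 + INR (r %% 3)) / 3 =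
  2 * PI * INR (r %% 3) / 3 + 2 * INR (r %/ 3) * PI by rewrite /=; field.
rewrite sin_period /chi3.
have : (r %% 3 < 3)%N by rewrite ltn_mod.
case: (r %% 3)%N => [|[|[|]]] //= _.
- by rewrite Rmult_0_r /Rdiv Rmult_0_l sin_0; ring.
- have -> : 2 * PI * 1 / 3 = PI - PI / 3 by field.
  by rewrite sin_PI_x sin_PI3; field.
- have -> : 2 * PI * (1 + 1) / 3 = PI / 3 + PI by field.
  by rewrite neg_sin sin_PI3; field.
Qed.

Lemma big_Rplus_cst (n : nat) (x : R) : \big[Rplus/0]_(j < n) x = INR n * x.
Proof.
elim: n => [|n IH]; first by rewrite big_ord0 /=; ring.
by rewrite big_ord_recr IH S_INR /=; ring.
Qed.

Lemma big_Rminus (n : nat) (F G : 'I_n -> R) :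
  \big[Rplus/0]_(j < n) (F j - G j) =
  \big[Rplus/0]_(j < n) F j - \big[Rplus/0]_(j < n) G j.
Proof.
elim/big_rec3: _ => [|j x y z _ ->]; ring.
Qed.

Lemma big_Rdiv (n : nat) (F : 'I_n -> R) (c : R) :
  \big[Rplus/0]_(j < n) (F j / c) = (\big[Rplus/0]_(j < n) F j) / c.
Proof.
elim/big_rec2: _ => [|j x y _ ->]; rewrite /Rdiv; ring.
Qed.

Definition wave (k : nat) (x : R) : R := cos (2 * PI * INR k * x).

Lemma continuous_wave (k : nat) (x : R) : continuous (wave k) x.
Proof.
apply: (ex_derive_continuous (wave k)); rewrite /wave; auto_derive; exact I.
Qed.

Lemma is_RInt_middle0 (a : nat) : (0 < a)%N ->
  is_RInt (fun x => middle_indicator a x * wave 0 x) 0 1 (1 / 3).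
Proof.
move=> a0.
have a0' : 0 < INR a by apply: lt_0_INR; lia.
have dS x : is_derive (fun x => x) x (wave 0 x).
  rewrite /wave /= Rmult_0_r Rmult_0_l cos_0; auto_derive => //; ring.
have := is_RInt_middle a0 dS (@continuous_wave 0).
rewrite (eq_bigr (fun=> 1 / 3 / INR a)); last by move=> j _; field; lra.
rewrite big_Rplus_cst.
by have -> : INR a * (1 / 3 / INR a) = 1 / 3 by field; lra.
Qed.

(** If [a] does not divide [k], both endpoint sums vanish. If [k = r a], the [a] terms of each sum
    coincide, with sines [- sqrt 3 / 2 * chi3 r] at [2/3] and the opposite at [1/3]. *)
Lemma is_RInt_middle_wave (a k : nat) : (0 < a)%N -> (0 < k)%N ->
  is_RInt (fun x => middle_indicator a x * wave k x) 0 1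
    (- (if (a %| k)%N then kappa / 3 * chi3 (k %/ a) / INR (k %/ a) else 0)).
Proof.
move=> a0 k0.
have a0' : 0 < INR a by apply: lt_0_INR; lia.
have k0' : 0 < INR k by apply: lt_0_INR; lia.
have pi0 := PI_RGT_0.
have w0 : 0 < 2 * PI * INR k by apply: Rmult_lt_0_compat; lra.
have dS x : is_derive (fun x => sin (2 * PI * INR k * x) / (2 * PI * INR k)) x (wave k x).
  by rewrite /wave; auto_derive => //; field; lra.
have := is_RInt_middle a0 dS (@continuous_wave k).
rewrite big_Rminus !big_Rdiv.
have sh (c : R) : \big[Rplus/0]_(j < a) sin (2 * PI * INR k * ((INR j + c) / INR a)) =
   \big[Rplus/0]_(j < a) sin (2 * PI * INR k * c / INR a + INR j * (2 * PI * INR k / INR a)).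
  by apply: eq_bigr => j _; congr (sin _); field; lra.
rewrite !sh {sh}.
case: ifP => [/dvdnP[r ek]|/negbT nd]; last first.
  by rewrite !sum_sin_nondivisor // /Rdiv Rmult_0_l Rminus_diag Ropp_0.
have r0 : (0 < r)%N by nia.
have r0' : 0 < INR r by apply: lt_0_INR; lia.
have eR : INR k = INR r * INR a by rewrite ek -multE mult_INR.
have sv (c : R) : \big[Rplus/0]_(j < a)
   sin (2 * PI * INR k * c / INR a + INR j * (2 * PI * INR k / INR a)) =
   INR a * sin (2 * PI * INR r * c).
  rewrite -big_Rplus_cst; apply: eq_bigr => j _.
  have -> : 2 * PI * INR k * c / INR a + INR j * (2 * PI * INR k / INR a) =
            2 * PI * INR r * c + 2 * INR (j * r)%N * PI.
    by rewrite -multE mult_INR eR; field; lra.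
  exact: sin_period.
rewrite !sv {sv}.
have -> : (k %/ a)%N = r by rewrite ek mulnK.
have -> : sin (2 * PI * INR r * (2 / 3)) = - (sqrt 3 / 2 * chi3 r).
  have -> : 2 * PI * INR r * (2 / 3) = - (2 * PI * INR r / 3) + 2 * INR r * PI by field.
  by rewrite sin_period sin_neg sin_third.
have -> : sin (2 * PI * INR r * (1 / 3)) = sqrt 3 / 2 * chi3 r.
  by rewrite -sin_third; congr (sin _); field.
rewrite eR /kappa.
set c := sqrt 3 / 2 * chi3 r.
have -> : INR a * - c / (2 * PI * (INR r * INR a)) -
          INR a * c / (2 * PI * (INR r * INR a)) =
          - (3 * sqrt 3 / (2 * PI) / 3 * chi3 r / INR r) by rewrite /c; field; lra.
by [].
Qed.

Lemma kappa_gt : 4 / 5 < kappa.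
Proof.
have pi0 := PI_RGT_0.
have piU : PI < 324 / 100.
  (* Eleven terms of the Leibniz series bound [PI] above by about 3.2323. *)
  have [_] := PI_ineq 5.
  by rewrite /tg_alt /PI_tg /=; lra.
have s3 : 1729 / 1000 < sqrt 3.
  by rewrite -(sqrt_Rsqr (1729 / 1000)); [apply: sqrt_lt_1|]; rewrite /Rsqr; lra.
rewrite /kappa; apply: (Rmult_lt_reg_r (2 * PI)); first lra.
rewrite /Rdiv Rmult_assoc (Rmult_assoc (3 * sqrt 3)) Rinv_l; lra.
Qed.

End FourierCoefficients.

(** * The deficiency function and its cosine coefficients *)

Section Positivity.

Local Open Scope R_scope.

Definition deficiency (s : seq nat) (x : R) : R :=
  INR (size s) + 1 - 3 * \big[Rplus/0]_(a <- s) middle_indicator a x.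

Definition weight (k a : nat) : R :=
  if (a %| k)%N then chi3 (k %/ a) / INR (k %/ a) else 0.

(* The [k]-th cosine coefficient of [deficiency s]; the value [1] at [k = 0] is its mean. *)
Definition coefficient (s : seq nat) (k : nat) : R :=
  if k == 0%N then 1 else kappa * \big[Rplus/0]_(a <- s) weight k a.

Lemma is_RInt_wave (k : nat) : is_RInt (wave k) 0 1 (if k == 0%N then 1 else 0).
Proof.
case: eqP => [->|k0].
  apply: (is_RInt_ext (fun=> 1)).
    by move=> x _; rewrite /wave /= Rmult_0_r Rmult_0_l cos_0.
  by have := is_RInt_const 0 1 1; rewrite /scal /= /mult /= Rminus_0_r Rmult_1_r.
have k0' : 0 < INR k by apply: lt_0_INR; lia.
have pi0 := PI_RGT_0.
have w0 : 0 < 2 * PI * INR k by apply: Rmult_lt_0_compat; lra.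
have := is_RInt_derive (fun x => sin (2 * PI * INR k * x) / (2 * PI * INR k)) (wave k) 0 1.
have -> : minus (sin (2 * PI * INR k * 1) / (2 * PI * INR k))
                (sin (2 * PI * INR k * 0) / (2 * PI * INR k)) = 0.
  have := sin_period 0 k.
  have -> : 0 + 2 * INR k * PI = 2 * PI * INR k * 1 by ring.
  by move->; rewrite Rmult_0_r sin_0 /Rdiv Rmult_0_l; apply: Rplus_opp_r.
apply=> x _; last exact: continuous_wave.
by rewrite /wave; auto_derive => //; field; lra.
Qed.

Lemma is_RInt_deficiency (s : seq nat) (k : nat) : all (leq 1) s ->
  is_RInt (fun x => deficiency s x * wave k x) 0 1 (coefficient s k).
Proof.
elim: s => [|a s IH] => [_|/= /andP[a0 /IH {}IH]].
  apply: (is_RInt_ext (wave k)).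
    by move=> x _; rewrite /deficiency big_nil /=; ring.
  by have := @is_RInt_wave k; rewrite /coefficient big_nil Rmult_0_r.
(* A new element [a] adds [1 - 3 * middle_indicator a x], of mean [0]; the mean thus stays [1], as
   for the empty sequence. *)
apply: (is_RInt_ext (fun x => plus (deficiency s x * wave k x)
          (minus (wave k x) (scal 3 (middle_indicator a x * wave k x))))).
  move=> x _; rewrite /deficiency big_cons.
  have -> : INR (size (a :: s)) = INR (size s) + 1 by exact: S_INR.
  by rewrite /plus /minus /Hierarchy.opp /scal /= /plus /mult /=; ring.
have -> : coefficient (a :: s) k = plus (coefficient s k)
    (minus (if k == 0%N then 1 else 0)
       (scal 3 (if k == 0%N then 1 / 3 else - (kappa / 3 * weight k a)))).
  rewrite /coefficient big_cons.
  by case: ifP => _; rewrite /plus /minus /Hierarchy.opp /scal /= /plus /mult /=; field.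
apply: is_RInt_plus => //; apply: is_RInt_minus; first exact: is_RInt_wave.
apply: is_RInt_scal; case: eqP => [->|k0]; first exact: is_RInt_middle0.
have := @is_RInt_middle_wave a k a0 ltac:(lia); rewrite /weight.
by case: ifP => _; rewrite ?Rmult_0_r // /Rdiv !Rmult_assoc.
Qed.

(** * Tests against nonnegative trigonometric polynomials *)

(** A product of two nonnegative functions has a nonnegative integral over [[0, 1]]; the constant
    [p0] is paired with the mean [1]. *)
Lemma coefficient_test (s : seq nat) (p0 p1 p2 p3 : R) (k1 k2 k3 : nat) :
  all (leq 1) s -> (forall x, 0 <= deficiency s x) ->
  (forall x, 0 <= p0 + p1 * wave k1 x + p2 * wave k2 x + p3 * wave k3 x) ->
  0 <= p0 + p1 * coefficient s k1 + p2 * coefficient s k2 + p3 * coefficient s k3.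
Proof.
move=> s0 d0 P0.
have h k p := is_RInt_scal _ 0 1 p _ (@is_RInt_deficiency s k s0).
have H := is_RInt_plus _ _ _ _ _ _ (is_RInt_plus _ _ _ _ _ _
  (is_RInt_plus _ _ _ _ _ _ (h 0%N p0) (h k1 p1)) (h k2 p2)) (h k3 p3).
have c0 : p0 = scal p0 (coefficient s 0) by rewrite /coefficient /scal /= /mult /=; ring.
rewrite {1}c0; apply: (is_RInt_ge_0 _ 0 1 _ _ H); first lra.
move=> x _; have := Rmult_le_pos _ _ (d0 x) (P0 x).
rewrite /plus /scal /= /mult /=.
have -> : wave 0 x = 1 by rewrite /wave /= Rmult_0_r Rmult_0_l cos_0.
lra.
Qed.

(** This is [|l - e(ax) - t e(bx)|^2] with [e(y) = exp(2 pi i y)], split into squared real and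
    imaginary parts. *)
Lemma wave_square_ge0 (l t x : R) (a b : nat) : (a <= b)%N ->
  0 <= (l * l + 1 + t * t) + (- 2 * l) * wave a x + (- 2 * l * t) * wave b x
       + (2 * t) * wave (b - a) x.
Proof.
move=> ab; rewrite /wave -minusE minus_INR; last by lia.
have -> : 2 * PI * (INR b - INR a) * x = 2 * PI * INR b * x - 2 * PI * INR a * x by ring.
rewrite cos_minus.
have := sin2_cos2 (2 * PI * INR b * x); have := sin2_cos2 (2 * PI * INR a * x).
move: (cos _) (sin _) (cos _) (sin _) => c s c' s'; rewrite /Rsqr => e e'.
have := Rle_0_sqr (l - c' - t * c); have := Rle_0_sqr (s' + t * s).
by rewrite /Rsqr; nra.
Qed.

Lemma wave2 (x : R) : wave 2 x = 2 * wave 1 x * wave 1 x - 1.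
Proof.
rewrite /wave -cos_2a_cos; congr (cos _); rewrite /=; ring.
Qed.

Lemma wave3 (x : R) : wave 3 x = 4 * wave 1 x * wave 1 x * wave 1 x - 3 * wave 1 x.
Proof.
rewrite /wave.
have -> : 2 * PI * INR 3 * x = 2 * (2 * PI * INR 1 * x) + 2 * PI * INR 1 * x.
  by rewrite /=; ring.
rewrite cos_plus sin_2a cos_2a_cos.
have := sin2_cos2 (2 * PI * INR 1 * x).
move: (cos _) (sin _) => c s; rewrite /Rsqr => e.
have -> : 2 * s * c * s = 2 * c * (s * s) by ring.
have -> : s * s = 1 - c * c by lra.
by ring.
Qed.

(** * Coefficients read off from divisors, and what they force on the least elements *)

Lemma big_Rplus_support (s t : seq nat) (F : nat -> R) : uniq s -> uniq t ->
  {subset t <= s} -> (forall a, a \in s -> a \notin t -> F a = 0) ->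
  \big[Rplus/0]_(a <- s) F a = \big[Rplus/0]_(a <- t) F a.
Proof.
move=> us ut ts F0.
rewrite (bigID (mem t)) /= [X in _ + X]big_seq_cond [X in _ + X]big1; last first.
  by move=> a /andP[]; exact: F0.
rewrite Rplus_0_r -big_filter; apply: perm_big; apply: uniq_perm => //.
  exact: filter_uniq.
move=> a; rewrite mem_filter; apply/andP/idP => [[]//|at_]; split=> //; exact: ts.
Qed.

Lemma weight_self (k : nat) : (0 < k)%N -> weight k k = 1.
Proof. by move=> k0; rewrite /weight dvdnn divnn k0 /chi3 /=; field. Qed.

(** Non-divisors of [k] have weight zero, so any part [t] of [s] containing the divisors of [k] in
    [s] gives the whole sum. *)
Lemma coefficient_support (s t : seq nat) (k : nat) : (0 < k)%N -> uniq s -> uniq t ->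
  {subset t <= s} -> (forall a, a \in s -> (a %| k)%N -> a \in t) ->
  coefficient s k = kappa * \big[Rplus/0]_(a <- t) weight k a.
Proof.
move=> k0 us ut ts st; rewrite /coefficient (gtn_eqF k0); congr (_ * _).
apply: big_Rplus_support => // a as_ at_; rewrite /weight; case: ifP => // ak.
by rewrite st in at_.
Qed.

Lemma coefficient_self (s : seq nat) (k : nat) : (0 < k)%N -> uniq s -> k \in s ->
  (forall a, a \in s -> (a %| k)%N -> a = k) -> coefficient s k = kappa.
Proof.
move=> k0 us ks h; rewrite (@coefficient_support _ [:: k]) //.
- by rewrite big_seq1 weight_self // Rmult_1_r.
- by move=> a; rewrite inE => /eqP ->.
- by move=> a as_ ak; rewrite inE (h a).
Qed.

(* Test polynomial [|3/2 - e(ax) - e(bx)|^2]: a minimal non-multiple [b] of [a] in [s] has no divisor in [s] but itself,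
   and [b - a] has none at all. *)
Lemma min_dvd_all (s : seq nat) (a : nat) : uniq s -> all (leq 1) s ->
  (forall x, 0 <= deficiency s x) -> a \in s -> (forall c, c \in s -> (a <= c)%N) ->
  forall c, c \in s -> (a %| c)%N.
Proof.
move=> us s0 d0 as_ mina c cs; apply/negPn/negP => nac.
have exb : exists b, (b \in s) && ~~ (a %| b)%N by exists c; rewrite cs.
case: (ex_minnP exb) => b /andP[bs nab] minb.
have a0 : (0 < a)%N by apply: (allP s0).
have ab : (a < b)%N.
  by have := mina b bs; rewrite leq_eqVlt => /orP[/eqP e|//]; rewrite e dvdnn in nab.
have small d : d \in s -> (d < b)%N -> (a %| d)%N.
  by move=> ds db; apply/negPn/negP => nad; have := minb d; rewrite ds nad /= => /(_ isT); lia.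
have ca : coefficient s a = kappa.
  apply: coefficient_self => // d ds da; apply/eqP.
  by rewrite eqn_leq (dvdn_leq a0 da) mina.
have cb : coefficient s b = kappa.
  apply: coefficient_self => //; first lia.
  move=> d ds db; have := dvdn_leq (ltn_trans a0 ab) db.
  rewrite leq_eqVlt => /orP[/eqP //|lt]; case/negP: nab.
  exact: dvdn_trans (small d ds lt) db.
have cba : coefficient s (b - a) = kappa * 0.
  rewrite (@coefficient_support _ [::]) ?big_nil //; first lia.
  move=> d ds dba; have dle : (d <= b - a)%N by apply: dvdn_leq => //; lia.
  case/negP: nab; rewrite -(subnK (ltnW ab)) dvdn_add //.
  by apply: dvdn_trans dba; apply: small => //; lia.
have := coefficient_test s0 d0 (fun x => wave_square_ge0 (3 / 2) 1 x (ltnW ab)).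
(* The test reads [0 <= 17/4 - 6 kappa], impossible for [kappa > 4/5]. *)
by rewrite ca cb cba; have := kappa_gt; lra.
Qed.

(* Test polynomial [(cos (2 pi x) - 4/5)^2]. *)
Lemma two_mem (s : seq nat) : uniq s -> all (leq 1) s ->
  (forall x, 0 <= deficiency s x) -> 1%N \in s -> 2%N \in s.
Proof.
move=> us s0 d0 s1; apply/negPn/negP => n2.
have c1 : coefficient s 1 = kappa.
  by apply: coefficient_self => // a _; rewrite dvdn1 => /eqP.
have c2 : coefficient s 2 = kappa * (- 1 / 2).
  rewrite (@coefficient_support _ [:: 1%N]) //.
  - by rewrite big_seq1 /weight /chi3 /=; lra.
  - by move=> a; rewrite inE => /eqP ->.
  - move=> a as_ /dvdn_leq a2; have a0 := allP s0 _ as_; rewrite inE.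
    have : a != 2%N by apply: contraNneq n2 => <-.
    by have := a2 isT; lia.
have := @coefficient_test s (1 / 2 + 16 / 25) (- 8 / 5) (1 / 2) 0 1 2 0 s0 d0.
rewrite c1 c2 => H.
have : 0 <= 1 / 2 + 16 / 25 + - 8 / 5 * kappa + 1 / 2 * (kappa * (-1 / 2)) + 0 * coefficient s 0.
  apply: H => x; rewrite wave2.
  by have := Rle_0_sqr (wave 1 x - 4 / 5); rewrite /Rsqr; lra.
(* The tested value is [57/50 - 37/20 kappa], which is negative. *)
by have := kappa_gt; lra.
Qed.

(* [kappa * omega j] is the [j]-th coefficient for [{1, 2}]. *)
Definition omega (j : nat) : R := weight j 1 + weight j 2.

(** The numerator over [j] is [chi3 j], plus [2 * chi3 (j / 2)] for even [j]. *)
Lemma omega_mod6 (j : nat) : (0 < j)%N ->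
  omega j = (match (j %% 6)%N with 1%N | 2%N => 1 | 4%N | 5%N => -1 | _ => 0 end) / INR j.
Proof.
move=> j0; rewrite /omega /weight dvd1n divn1 /chi3.
have j0' : 0 < INR j by apply: lt_0_INR; lia.
have m6 : (j %% 6 < 6)%N by rewrite ltn_mod.
have e3 : (j %% 3 = (j %% 6) %% 3)%N by lia.
have e2 : (2 %| j) = (2 %| j %% 6)%N by lia.
have e32 : (2 %| j)%N -> ((j %/ 2) %% 3 = ((j %% 6) %/ 2) %% 3)%N by lia.
have eh : (2 %| j)%N -> INR (j %/ 2) = INR j / 2.
  by move=> d; rewrite -{2}(divnK d) -multE mult_INR /=; field.
case: ifP => d; last first.
  rewrite e3; rewrite e2 in d; move: d m6.
  by case: (j %% 6)%N => [|[|[|[|[|[|]]]]]] //= _ _; field; lra.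
rewrite e3 e32 // eh //; rewrite e2 in d; move: d m6.
by case: (j %% 6)%N => [|[|[|[|[|[|]]]]]] //= _ _; field; lra.
Qed.

Lemma omega_bounds (j : nat) : (0 < j)%N -> - / INR j <= omega j <= / INR j.
Proof.
move=> j0; rewrite omega_mod6 // /Rdiv.
have j0' : 0 < / INR j by apply: Rinv_0_lt_compat; apply: lt_0_INR; lia.
by case: (j %% 6)%N => [|[|[|[|[|[|]]]]]] *; lra.
Qed.

(** Below [m] the coefficients are those of [{1, 2}], while [m] itself adds [kappa] to the [m]-th
    one; this excess is incompatible with nonnegativity. *)
Lemma no_third_element (s : seq nat) (m : nat) : uniq s -> all (leq 1) s ->
  (forall x, 0 <= deficiency s x) -> 1%N \in s -> 2%N \in s -> m \in s -> (2 < m)%N ->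
  (forall a, a \in s -> (2 < a)%N -> (m <= a)%N) -> False.
Proof.
move=> us s0 d0 s1 s2 ms m2 minm.
have kap := kappa_gt.
have c1 : coefficient s 1 = kappa.
  by apply: coefficient_self => // a _; rewrite dvdn1 => /eqP.
have cm : coefficient s m = kappa * (omega m + 1).
  rewrite (@coefficient_support _ [:: 1%N; 2%N; m]) //; first last.
  - move=> a as_ /dvdn_leq am; have a0 := allP s0 _ as_; rewrite !inE.
    by have := minm a as_; lia.
  - by move=> a; rewrite !inE => /or3P[] /eqP ->.
  - by rewrite /= !inE; lia.
  - lia.
  by rewrite !big_cons big_nil weight_self; [rewrite /omega; ring | lia].
have cj j : (0 < j < m)%N -> coefficient s j = kappa * omega j.
  move=> /andP[j0 jm]; rewrite (@coefficient_support _ [:: 1%N; 2%N]) //.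
  - by rewrite !big_cons big_nil /omega; ring.
  - by move=> a; rewrite !inE => /orP[] /eqP ->.
  - move=> a as_ /dvdn_leq am; have a0 := allP s0 _ as_; rewrite !inE.
    by have := minm a as_; lia.
have [m3|m3] := eqVneq m 3%N.
  (* Test polynomial [z^2 - z^3] with [z = cos (2 pi x)]. *)
  rewrite m3 in cm.
  have := @coefficient_test s (1 / 2) (- 3 / 4) (1 / 2) (- 1 / 4) 1 2 3 s0 d0.
  rewrite c1 cm cj ?m3 // /omega /weight /chi3 /=; set H := (X in _ -> 0 <= X) => h.
  have : 0 <= H.
    apply: h => x; rewrite wave2 wave3.
    have c_le1 : wave 1 x <= 1 by have [] := COS_bound (2 * PI * INR 1 * x).
    have := Rmult_le_pos _ (1 - wave 1 x) (Rle_0_sqr (wave 1 x)).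
    by rewrite /Rsqr; lra.
  (* Here [H] equals [1/2 - 3/4 kappa], which is negative. *)
  by rewrite /H; lra.
have m1 : (1 <= m)%N by lia.
(* Test polynomial [|5/4 - e(x) - 3/4 e(mx)|^2]; the case [m = 4] is tight enough to
   need [kappa > 4/5]. *)
have := coefficient_test s0 d0 (fun x => wave_square_ge0 (5 / 4) (3 / 4) x m1).
rewrite c1 cm cj; last by lia.
(* With this bound the test becomes [0 <= 25/8 - 125/32 kappa], that is [kappa <= 4/5]; [m = 4]
   gives equality in the bound. *)
suff : omega (m - 1) <= 5 / 4 * omega m + 5 / 16.
  have k0 : 0 < kappa by lra.
  by move=> /(Rmult_le_compat_l kappa _ _ (Rlt_le _ _ k0)); lra.
(* From [8] on, [|omega j| <= 1/j] suffices, since [1/7 <= 5/16 - 5/32]; the values [4] to [7] are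
   computed. *)
have [m8|m8] := leqP 8 m.
  have [h1 _] := omega_bounds m1.
  have [_ h2] := @omega_bounds (m - 1) ltac:(lia).
  have r8 : 8 <= INR m by have := le_INR 8 m ltac:(lia); rewrite /=; lra.
  have i1 : / INR m <= / 8 by apply: Rinv_le_contravar; lra.
  have i2 : / INR (m - 1)%N <= / 7.
    by apply: Rinv_le_contravar; [lra | have := le_INR 7 (m - 1)%N ltac:(lia); rewrite /=; lra].
  lra.
have : m \in [:: 4; 5; 6; 7]%N by rewrite !inE; lia.
by rewrite !inE => /or4P[] /eqP ->; rewrite !omega_mod6 //= ?modn_small //=; lra.
Qed.

End Positivity.

(** * Back to finite sets of integers *)

Local Open Scope nat_scope.

(** The elements of [A] in the middle third at [x] form a sum-free set [B], whence
    [3 |B| <= 3 s(A) <= n + 1]. *)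
Lemma deficiency_ge0 (A : {fset nat}) (x : R) :
  3 * max_sum_free A <= #|` A|%fset + 1 -> (0 <= deficiency A x)%Re.
Proof.
move=> small; pose B := [fset a in [seq a <- A | middle_third x a]]%fset.
have memB a : (a \in B) = (middle_third x a) && (a \in A).
  by rewrite in_fset /= mem_filter.
have BA : B \in fpowerset A.
  by rewrite fpowersetE; apply/fsubsetP => a; rewrite memB => /andP[].
have sfB : sum_free B.
  apply/sum_freeP => -[a [b [c [aB bB cB e]]]]; move: aB bB cB; rewrite -e !memB.
  by move=> /andP[ha _] /andP[hb _] /andP[hab _]; have := middle_third_sum_free ha hb; rewrite hab.
have cB : #|` B|%fset = count (middle_third x) A.
  by rewrite card_fseq undup_id ?size_filter // filter_uniq // fset_uniq.
have le : count (middle_third x) A <= max_sum_free A.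
  by rewrite -cB; apply: (leq_bigmax_seq B).
have -> : deficiency A x = (INR (size A) + 1 - 3 * INR (count (middle_third x) A))%Re.
  rewrite /deficiency; congr (_ - 3 * _)%Re.
  elim: (A : seq nat) => [|a s IH]; first by rewrite big_nil.
  rewrite big_cons IH /= -plusE plus_INR /middle_indicator.
  by case: middle_third.
have := le_INR (3 * count (middle_third x) A) (size A + 1)%coq_nat ltac:(lia).
rewrite plus_INR -multE mult_INR /=; lra.
Qed.

Theorem theorem1 (A : {fset nat}) (n : nat)
    (Apos : forall a : nat, a \in A -> 0 < a)
    (cardA : #|` A|%fset = n)
    (gcdA : \big[gcdn/0]_(a <- A) a = 1) :
  A = [fset 1; 2]%fset \/
  (((n%:R + 2) / 3 : rat) <= (max_sum_free A)%:R)%R.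
Proof.
(* Over the integers, failure of the bound means [3 s(A) <= n + 1], exactly what nonnegativity of
   the deficiency requires. *)
have [big|small] := leqP (n + 2) (3 * max_sum_free A).
  right; rewrite Num.Theory.ler_pdivrMr //.
  rewrite -[2%R]/(2%:R)%R -[3%R]/(3%:R)%R -GRing.natrD -GRing.natrM Num.Theory.ler_nat.
  by rewrite mulnC.
left.
have d0 x : (0 <= deficiency A x)%Re by apply: deficiency_ge0; lia.
have s0 : all (leq 1) A by apply/allP.
have uA := fset_uniq A.
have exA : exists a, a \in A.
  have [A0|[a aA]] := fset_0Vmem A; last by exists a.
  by move: gcdA; rewrite A0 big_nil.
case: (ex_minnP exA) => a aA mina.
have a1 : a = 1.
  (* The least element divides every element, hence the gcd. *)
  apply/eqP; rewrite -dvdn1 -gcdA big_seq; elim/big_ind: _ => [|b c ab ac|b bA] //.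
    by rewrite dvdn_gcd ab.
  exact: (min_dvd_all uA s0 d0 aA mina).
rewrite {}a1 in aA mina.
have A2 : 2 \in A by apply: two_mem.
(* An element beyond [1] and [2] would yield a least one, which is excluded. *)
have [ex3|no3] := boolP (has (leq 3) A).
  have {}ex3 : exists m, (m \in A) && (2 < m) by case/hasP: ex3 => m mA m3; exists m; rewrite mA.
  case: (ex_minnP ex3) => m /andP[mA m2] minm.
  case: (@no_third_element A m) => // c cA c2; apply: minm; by rewrite cA.
apply/fsetP => c; rewrite !inE; apply/idP/orP => [cA|[] /eqP -> //].
have := hasPn no3 c cA; have := Apos c cA; lia.
Qed.
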